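(* Let $(X,\preceq,G)$ be a complete partially ordered $G$-metric space and let $T:X\to X$ be a mapping satisfying the following conditions: 1. $T$ is $G$-continuous or $(X,\preceq,G)$ is regular non-decreasing; 2. $T$ is non-decreasing; 3. there exists $x_0\in X$ with $x_0\preceq Tx_0$; 4. there exist $\psi\in\Psi$ and $\phi\in\Phi$ such that for all $x,y,z\in X$ with $x\preceq y\preceq z$, $$\psi(G(Tx,Ty,Tz))\le \psi(M(x,y,z))-\phi(M(x,y,z)),$$ where $$M(x,y,z)=\max\Big\{G(x,Tx,y),\,G(x,Tx,z),\,G(x,y,z),\,G(y,Ty,Ty),\,G(z,Tz,Tz),\,\tfrac12\big[G(x,Ty,Tz)+G(Tx,y,z)\big]\Big\}.$$ Let $T_X$ denote the set of all fixed points of $T$ in $X$, and suppose moreover that for any $x,y\in T_X$ there exists $z\in X$ such that $x\preceq z$, $y\preceq z$, and the sequence $\{T^mz\}_{m}$ is convergent in $(X,G)$. Then $T$ has a unique fixed point.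
   Context: A $G$-metric on a nonempty set $X$ is a function $G:X\times X\times X\to[0,\infty)$ such that: (G1) $G(x,y,z)=0$ if $x=y=z$; (G2) $0<G(x,x,y)$ for all $x,y\in X$ with $x\ne y$; (G3) $G(x,x,y)\le G(x,y,z)$ for all $x,y,z\in X$ with $y\neq z$; (G4) $G$ is invariant under all permutations of its three arguments; (G5) $G(x,y,z)\le G(x,a,a)+G(a,y,z)$ for all $x,y,z,a\in X$. A partially ordered $G$-metric space $(X,\preceq,G)$ is a nonempty set $X$ with a partial order $\preceq$ and a $G$-metric $G$. A sequence $(x_n)$ $G$-converges (is convergent in $(X,G)$) to $x$ if $G(x,x_n,x_m)\to0$ as $n,m\to\infty$; it is $G$-Cauchy if $G(x_n,x_m,x_l)\to 0$ as $n,m,l\to\infty$; the space is complete if every $G$-Cauchy sequence $G$-converges to some point of $X$. $T$ is $G$-continuous if $x_n\to x$ implies $Tx_n\to Tx$ (in the sense of $G$-convergence). $T$ is non-decreasing if $x\preceq y$ implies $Tx\preceq Ty$. $(X,\preceq,G)$ is regular non-decreasing if for every $\preceq$-non-decreasing sequence $(x_n)$ in $X$ with $x_n\to x^*$ one has $x_n\preceq x^*$ for all $n\in\mathbb N$. $T^m$ denotes the $m$-fold iterate of $T$. $\Psi$ is the set of functions $\psi:[0,\infty)\to[0,\infty)$ that are continuous, non-decreasing and satisfy $\psi(t)=0$ iff $t=0$. $\Phi$ is the set of functions $\phi:[0,\infty)\to[0,\infty)$ that are lower semi-continuous and satisfy $\phi(t)=0$ iff $t=0$. *)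

(* Defs.v *)
From HB Require Import structures.
From mathcomp Require Import all_boot all_order all_algebra.
From mathcomp Require Import all_classical all_reals all_analysis.
Set Implicit Arguments.
Unset Strict Implicit.
Unset Printing Implicit Defensive.
Import Order.TTheory GRing.Theory Num.Theory.
Import numFieldNormedType.Exports.
Local Open Scope classical_set_scope.
Local Open Scope ring_scope.

Record is_Gmetric (R : realType) (X : Type) (G : X -> X -> X -> R) : Prop := {
  Gmetric_ge0 : forall x y z, 0 <= G x y z;
  Gmetric_xxx : forall x, G x x x = 0;
  Gmetric_gt0 : forall x y, x <> y -> 0 < G x x y;
  Gmetric_le : forall x y z, y <> z -> G x x y <= G x y z;
  Gmetric_sym : forall x y z,
    [/\ G x y z = G x z y, G x y z = G y x z, G x y z = G y z x,
        G x y z = G z x y & G x y z = G z y x];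
  Gmetric_triangle : forall x y z a, G x y z <= G x a a + G a y z }.

(* The filter_prod's express that the indices tend to infinity
   independently of one another. *)
Definition G_cvg (R : realType) (X : Type) (G : X -> X -> X -> R)
    (u : nat -> X) (x : X) : Prop :=
  (fun p : nat * nat => G x (u p.1) (u p.2)) @ filter_prod \oo \oo --> (0 : R).

Definition G_cauchy (R : realType) (X : Type) (G : X -> X -> X -> R)
    (u : nat -> X) : Prop :=
  (fun p : nat * nat * nat => G (u p.1.1) (u p.1.2) (u p.2))
    @ filter_prod (filter_prod \oo \oo) \oo --> (0 : R).

Definition G_complete (R : realType) (X : Type) (G : X -> X -> X -> R) : Prop :=
  forall u : nat -> X, G_cauchy G u -> exists x, G_cvg G u x.

Definition G_continuous (R : realType) (X : Type) (G : X -> X -> X -> R)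
    (T : X -> X) : Prop :=
  forall (u : nat -> X) (x : X), G_cvg G u x -> G_cvg G (T \o u) (T x).

Definition regular_nondecreasing (R : realType) (d : Order.disp_t)
    (X : porderType d) (G : X -> X -> X -> R) : Prop :=
  forall (u : nat -> X) (x : X),
    nondecreasing_seq u -> G_cvg G u x -> forall n, (u n <= x)%O.

(* A function from [0, +oo[ to itself is represented by a function on R of
   which only the values on [0, +oo[ are constrained; continuity and
   semi-continuity are for the subspace topology of [0, +oo[. *)
Record Psi (R : realType) (psi : R -> R) : Prop := {
  Psi_ge0 : forall t, 0 <= t -> 0 <= psi t;
  Psi_continuous : {within `[0, +oo[, continuous psi};
  Psi_nondecreasing : forall s t, 0 <= s -> s <= t -> psi s <= psi t;
  Psi_eq0 : forall t, 0 <= t -> (psi t = 0 <-> t = 0) }.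

Record Phi (R : realType) (phi : R -> R) : Prop := {
  Phi_ge0 : forall t, 0 <= t -> 0 <= phi t;
  Phi_lsc : lower_semicontinuous
    (fun t : subspace (`[0, +oo[ : set R) => (phi t)%:E);
  Phi_eq0 : forall t, 0 <= t -> (phi t = 0 <-> t = 0) }.

Definition contraction_max (R : realType) (X : Type) (G : X -> X -> X -> R)
    (T : X -> X) (x y z : X) : R :=
  Num.max (G x (T x) y)
 (Num.max (G x (T x) z)
 (Num.max (G x y z)
 (Num.max (G y (T y) (T y))
 (Num.max (G z (T z) (T z))
          (2^-1 * (G x (T y) (T z) + G (T x) y z)))))).

Definition fixed_points (X : Type) (T : X -> X) : set X := [set x | T x = x].

(* Main.v *)
Require Import Defs.
From HB Require Import structures.
From mathcomp Require Import all_boot all_order all_algebra.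
From mathcomp Require Import all_classical all_reals all_analysis.
From mathcomp Require Import lra.
Set Implicit Arguments.
Unset Strict Implicit.
Unset Printing Implicit Defensive.
Import Order.TTheory GRing.Theory Num.Theory.
Import numFieldNormedType.Exports.
Local Open Scope classical_set_scope.
Local Open Scope ring_scope.

(** From [psi (G Tx Ty Tz) <= psi M - phi M] one only needs the following: if
    [G Tx Ty Tz] and [M x y z] can both be made arbitrarily close to the same
    [e >= 0] along chains [x <= y <= z], then [e = 0]. Every step consists in
    choosing a triple for which both quantities have the same limit. A [G]-metric
    need not satisfy [G x x y = G x y y], so the choice of the repeated entry
    matters: [(x_n, x_n, x_m)] for the Cauchy property of the orbit,
    [(x_n, x, x)] for the limit [x] being fixed in the regular case, and
    [(x, x, T^m z)] for uniqueness. *)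

(** * The contraction inequality at a common limit value *)

Lemma gap_eq0 (R : realType) (psi phi : R -> R) (e : R) :
  Psi psi -> Phi phi -> 0 <= e ->
  (forall r : R, 0 < r -> exists s t : R,
    [/\ `|s - e| < r, `|t - e| < r & psi s <= psi t - phi t]) ->
  e = 0.
Proof.
move=> Hpsi Hphi e0 H; apply: contrapT => /eqP eN0.
have ep : 0 < e by rewrite lt_neqAle eq_sym eN0.
have phip : 0 < phi e.
  rewrite lt_neqAle (Phi_ge0 Hphi) // andbT eq_sym.
  by apply: contra_neq eN0 => /(Phi_eq0 Hphi e0).
have eA : [set` `[(0:R), +oo[] e by rewrite /= in_itv /= andbT.
(* Close to [e], [psi] differs from [psi e] by less than [phi e / 4] and [phi] exceeds [phi e / 2].
   Hence [psi t - phi t < psi e - phi e / 4 < psi s], a contradiction. *)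
have /(_ e) /cvgrPdist_lt /(_ (phi e / 4)) := Psi_continuous Hpsi.
rewrite divr_gt0 // => /(_ isT).
rewrite {1}/nbhs /= -(nbhs_subspace_in eA) => /nbhs_ballP [r1 /= r10 H1].
have lt3 : ((phi e / 2)%:E < (phi e)%:E)%E by rewrite lte_fin; lra.
have [V + HV] := Phi_lsc Hphi lt3.
rewrite {1}/nbhs /= -(nbhs_subspace_in eA) => /nbhs_ballP [r2 /= r20 H2].
(* The entry [e] of the minimum keeps [s] and [t] in the half-line on which [psi] and [phi] are
   constrained. *)
have [|s [t [+ + ]]] := H (Num.min e (Num.min r1 r2)).
  by rewrite !lt_min ep r10.
rewrite !lt_min => /and3P [se s1 s2] /and3P [te t1 t2].
have inA x : `|x - e| < e -> [set` `[(0:R), +oo[] x.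
  by rewrite /= in_itv /= andbT ltr_distl => /andP[]; lra.
have /= Hs : `|psi e - psi s| < phi e / 4.
  by apply: H1 (inA _ se); rewrite /ball /= distrC.
have /= Ht : `|psi e - psi t| < phi e / 4.
  by apply: H1 (inA _ te); rewrite /ball /= distrC.
have Hpt : phi e / 2 < phi t.
  by rewrite -lte_fin; apply/HV/H2; [rewrite /ball /= distrC|exact: inA].
move: Hs Ht; rewrite !ltr_distl => /andP[? ?] /andP[? ?]; lra.
Qed.

(** * Triangle inequalities and convergence in a [G]-metric space *)

Section GMetric.
Variables (R : realType) (X : Type) (G : X -> X -> X -> R).
Hypothesis G_metric : is_Gmetric G.

Lemma GC12 x y z : G x y z = G y x z.
Proof. by case: (Gmetric_sym G_metric x y z). Qed.

Lemma GC23 x y z : G x y z = G x z y.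
Proof. by case: (Gmetric_sym G_metric x y z). Qed.

Lemma GC13 x y z : G x y z = G z y x.
Proof. by case: (Gmetric_sym G_metric x y z). Qed.

Lemma G_triangle1 a x y z : G x y z <= G x a a + G a y z.
Proof. exact: Gmetric_triangle. Qed.

Lemma G_triangle2 a x y z : G x y z <= G y a a + G x a z.
Proof. by rewrite GC12 (GC12 x a); exact: G_triangle1. Qed.

Lemma G_triangle3 a x y z : G x y z <= G z a a + G x y a.
Proof. by rewrite GC13 (GC13 x y a); exact: G_triangle1. Qed.

(** Substitute for the possibly failing symmetry [G x y y = G y x x]: reversing a distance costs a
    factor 2. *)
Lemma G_double x y : G x y y <= 2 * G y x x.
Proof. by have := G_triangle2 x x y y; rewrite (GC13 x x y); lra. Qed.

Lemma G_eq0 x y : G x y y = 0 -> x = y.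
Proof.
move=> H; apply: contrapT => xy; have := Gmetric_gt0 G_metric xy.
by rewrite (GC13 x x y); have := G_double y x; lra.
Qed.

Lemma G_cvgP u x : G_cvg G u x <->
  forall e, 0 < e -> exists N, forall n m,
    (N <= n)%N -> (N <= m)%N -> G x (u n) (u m) < e.
Proof.
split.
- move=> /cvgr0Pnorm_lt H e /H [[A B] /= [[N1 _ H1] [N2 _ H2]] HAB].
  exists (maxn N1 N2) => n m; rewrite !geq_max => /andP[n1 n2] /andP[m1 m2].
  apply: le_lt_trans (ler_norm _) _.
  by apply: (HAB (n, m)); split; [exact: H1|exact: H2].
- move=> H; apply/cvgr0Pnorm_lt => e /H [N HN].
  exists ([set n | (N <= n)%N], [set n | (N <= n)%N]); first by split; exists N.
  move=> [n m] /= [nN mN].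
  by rewrite ger0_norm ?(Gmetric_ge0 G_metric) // HN.
Qed.

(** [G_double] removes the order of the two indices, and the triangle inequality through [u m]
    splits a triple into two pairs. *)
Lemma G_cauchy_ordered u :
  (forall e, 0 < e -> exists N, forall n m, (N <= n)%N -> (n <= m)%N ->
    G (u n) (u n) (u m) < e) ->
  G_cauchy G u.
Proof.
move=> H; apply/cvgr0Pnorm_lt => e e0.
have [|N HN] := H (e / 4); first by rewrite divr_gt0.
have HN' n m : (N <= n)%N -> (N <= m)%N -> G (u n) (u m) (u m) < e / 2.
  move=> nN mN; case: (leqP n m) => nm.
  - have := HN _ _ nN nm; have := G_double (u n) (u m).
    by rewrite (GC13 (u n) (u n)); lra.
  - have := HN _ _ mN (ltnW nm); rewrite (GC13 (u n)); lra.
set A := [set n | (N <= n)%N]; have oA : \oo A by exists N.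
exists (A `*` A, A) => /=; first by split => //; exists (A, A).
move=> [[n m] l] /= [[nN mN] lN].
rewrite ger0_norm ?(Gmetric_ge0 G_metric) //.
have := G_triangle1 (u m) (u n) (u m) (u l); have := HN' _ _ nN mN.
by have := HN' _ _ lN mN; rewrite (GC13 (u l)); lra.
Qed.

Lemma G_cvg_unique u x y : G_cvg G u x -> G_cvg G u y -> x = y.
Proof.
move=> /G_cvgP ux /G_cvgP uy; apply: G_eq0; apply/eqP.
rewrite eq_le (Gmetric_ge0 G_metric) andbT leNgt; apply/negP => e0.
have [|N1 H1] := ux (G x y y / 4); first by rewrite divr_gt0.
have [|N2 H2] := uy (G x y y / 4); first by rewrite divr_gt0.
have a1 := leq_maxl N1 N2; have a2 := leq_maxr N1 N2.
have := G_triangle1 (u (maxn N1 N2)) x y y; have := H1 _ _ a1 a1.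
have := H2 _ _ a2 a2; have := G_double (u (maxn N1 N2)) y; lra.
Qed.

Lemma G_cvgS u x : G_cvg G u x -> G_cvg G (fun n => u n.+1) x.
Proof.
move=> /G_cvgP H; apply/G_cvgP => e /H [N HN].
by exists N => n m nN mN; apply: HN; apply: leqW.
Qed.

End GMetric.

(** * Iterates of [T] and estimates on [contraction_max] *)

Definition orbit (X : Type) (T : X -> X) (x : X) (n : nat) : X := iter n T x.

Section FixedPoint.
Variables (R : realType) (d : Order.disp_t) (X : porderType d).
Variables (G : X -> X -> X -> R) (T : X -> X).
Hypothesis G_metric : is_Gmetric G.
Hypothesis T_nondecreasing : {homo T : x y / (x <= y)%O}.
(** All that is retained of [psi] and [phi]: the conclusion of [gap_eq0] for the contraction
    condition. *)
Hypothesis T_gap : forall e : R, 0 <= e ->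
  (forall r : R, 0 < r -> exists x y z, [/\ (x <= y)%O, (y <= z)%O,
     `|G (T x) (T y) (T z) - e| < r & `|contraction_max G T x y z - e| < r]) ->
  e = 0.

Local Notation G0 := (Gmetric_ge0 G_metric).
Local Notation Gxxx := (Gmetric_xxx G_metric).
Local Notation tri1 := (G_triangle1 G_metric).
Local Notation tri2 := (G_triangle2 G_metric).
Local Notation tri3 := (G_triangle3 G_metric).
Local Notation dbl := (G_double G_metric).
Local Notation C12 := (GC12 G_metric).
Local Notation C13 := (GC13 G_metric).
Local Notation C23 := (GC23 G_metric).

(** The averaged term reduces to half of [G x (T (T x)) (T (T x))], at most [(a + b) / 2] by the
    triangle inequality through [T x]. *)
Lemma contraction_max_step x : let a := G x (T x) (T x) in
  let b := G (T x) (T (T x)) (T (T x)) in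
  contraction_max G T x (T x) (T x) = Num.max a b.
Proof.
move=> a b; rewrite /contraction_max -/a -/b Gxxx addr0.
apply/eqP; rewrite eq_le !ge_max !le_max !lexx !orbT !andTb /=.
apply/andP; split => //; have := tri1 (T x) x (T (T x)) (T (T x)).
rewrite -/a -/b; case: (leP a b); lra.
Qed.

(** If the second step were the longer one, the maximum would equal it too, and [T_gap] would make
    it 0. *)
Lemma step_decreasing x : (x <= T x)%O ->
  G (T x) (T (T x)) (T (T x)) <= G x (T x) (T x).
Proof.
move=> xT; rewrite leNgt; apply/negP => lt.
have := G0 x (T x) (T x); rewrite leNgt => /negP; apply.
rewrite -(T_gap (G0 (T x) (T (T x)) (T (T x)))) // => r r0.
exists x, (T x), (T x); split => //; first by rewrite subrr normr0.
by rewrite contraction_max_step max_r ?subrr ?normr0 // ltW.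
Qed.

(** Replacing one argument [x] by [T x], or [y] by [T y], raises [G] by less than [2 * r] because of
    [G_double], and lowers it by less than [r]. Three replacements give [6 * r] and [3 * r]. *)
Lemma contraction_max_near x y r :
  G x (T x) (T x) < r -> G y (T y) (T y) < r ->
  [/\ G x x y <= contraction_max G T x x y,
      contraction_max G T x x y <= G x x y + 4 * r,
      G x x y - 3 * r <= G (T x) (T x) (T y) &
      G (T x) (T x) (T y) <= G x x y + 6 * r].
Proof.
move=> ax ay.
have bx := dbl (T x) x; have b'y := dbl (T y) y; have Dp := G0 x x y.
have r0 : 0 < r := le_lt_trans (G0 _ _ _) ax.
have t1 : G x (T x) y <= G x x y + 2 * r by have := tri2 x x (T x) y; lra.
have t2 := tri3 y x (T x) (T y).
have t3 := tri1 (T x) x x y; rewrite (C12 (T x) x y) in t3.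
have t4 := tri1 (T x) x (T x) y; have t5 := tri3 (T y) (T x) (T x) y.
have t6 := tri3 y (T x) (T x) (T y); have t7 := tri1 x (T x) (T x) y.
split; [|rewrite /contraction_max !ge_max|lra|lra].
- by rewrite /contraction_max !le_max lexx !orbT.
- rewrite (C23 x (T x) x) (C13 x x (T x)) (C12 (T x) x y).
  by repeat (apply/andP; split); lra.
Qed.

(** Monotonicity keeps [x] below every iterate of [z]. On [(x, x, v N)] both quantities of [T_gap]
    tend to [G l x x], the step terms vanishing. *)
Lemma fixed_point_le_limit x z l : T x = x -> (x <= z)%O ->
  G_cvg G (orbit T z) l -> x = l.
Proof.
move=> Tx xz cl; set v := orbit T z in cl.
have xv m : (x <= v m)%O.
  by elim: m => [//|m IH]; rewrite -Tx; apply: T_nondecreasing.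
apply/esym/(G_eq0 G_metric); apply: (T_gap (G0 _ _ _)) => r r0.
move/(G_cvgP G_metric): cl => /(_ (r / 8)) [|N HN].
  by rewrite divr_gt0.
have h := HN _ _ (leqnn N) (leqnn N).
have h' := HN _ _ (leqnSn N) (leqnSn N).
have t0 := dbl (v N) l; have t1 := dbl (v N.+1) l.
have t2 := tri1 l (v N) x x; have t3 := tri1 (v N) l x x.
have t4 := tri1 l (v N.+1) x x; have t5 := tri1 (v N.+1) l x x.
have t6 := tri1 l (v N) (v N.+1) (v N.+1); have Dp := G0 (v N) x x.
exists x, x, (v N); split => //.
- by rewrite Tx -[T (v N)]/(v N.+1) (C13 x x) ltr_distl; lra.
- rewrite ltr_distl; apply/andP; split.
    apply: (@lt_le_trans _ _ (G (v N) x x)); first lra.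
    by rewrite (C13 (v N)) /contraction_max !le_max lexx !orbT.
  apply: (@le_lt_trans _ _ (G l x x + r / 2)); last lra.
  rewrite /contraction_max !Tx !ge_max Gxxx -[T (v N)]/(v N.+1).
  rewrite (C13 x x (v N)) (C13 x x (v N.+1)).
  by repeat (apply/andP; split); have := G0 l x x; lra.
Qed.

(** * The orbit of [x0]: Cauchy property and invariance of its limit *)

Variable x0 : X.
Hypothesis T_start : (x0 <= T x0)%O.
Local Notation u := (orbit T x0).

Lemma orbit_nondecreasing : nondecreasing_seq u.
Proof.
by apply/nondecreasing_seqP; elim=> [//|n IH]; exact: T_nondecreasing.
Qed.

Lemma orbit_le_step n : (u n <= T (u n))%O.
Proof. by have := orbit_nondecreasing (leqnSn n). Qed.

(** The decreasing step lengths approach their infimum. Two consecutive ones are the two quantities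
    of [T_gap], so this infimum is 0. *)
Lemma step_cvg0 e : 0 < e -> exists N, forall n, (N <= n)%N ->
  G (u n) (u n.+1) (u n.+1) < e.
Proof.
move=> e0; pose a n := G (u n) (u n.+1) (u n.+1).
have aS n : a n.+1 <= a n by apply/step_decreasing/orbit_le_step.
have ad n m : (n <= m)%N -> a m <= a n.
  by move=> nm; apply: (nonincreasing_seqP a).1 nm.
have lb : lbound (range a) 0 by move=> _ [n _ <-]; exact: G0.
have hl : has_lbound (range a) by exists 0.
have ne : range a !=set0 by exists (a 0%N), 0%N.
have il n : inf (range a) <= a n by apply: ge_inf => //; exists n.
have i0 : inf (range a) = 0.
  apply: T_gap; first exact: lb_le_inf.
  move=> r r0; have [_ [n _ <-] an] := inf_adherent r0 (conj ne hl).
  exists (u n), (u n.+1), (u n.+1); split => //; first exact: orbit_le_step.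
  - rewrite -[G _ _ _]/(a n.+1) ltr_distl; have := il n.+1; have := aS n; lra.
  - rewrite contraction_max_step max_l; last exact: aS.
    by rewrite -[G _ _ _]/(a n) ltr_distl; have := il n; lra.
have [_ [n _ <-] an] := inf_adherent e0 (conj ne hl).
by exists n => m /ad; rewrite -[G _ _ _]/(a m); lra.
Qed.

(** If the property fails at [e], the first crossing of [e] after a late index [n] gives a distance
    close to [e]; steps being short, [contraction_max_near] brings both quantities close to [e]. *)
Lemma orbit_cauchy : G_cauchy G u.
Proof.
apply: (G_cauchy_ordered G_metric) => e e0; apply: contrapT => nH.
suff e_eq0 : e = 0 by move: e0; rewrite e_eq0 ltxx.
apply: (T_gap (ltW e0)) => r r0.
(* The crossing overshoots [e] by less than [2 * (r / 16)] and [contraction_max_near] adds at most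
   [6 * (r / 16)], in total [r / 2]. *)
have [|N HN] := step_cvg0 (e := r / 16); first by rewrite divr_gt0.
have [n [nN [m0 H0]]] : exists n, (N <= n)%N /\
    exists m, (n <= m)%N && (e <= G (u n) (u n) (u m)).
  apply: contrapT => H; apply: nH; exists N => n m nN nm.
  rewrite ltNge; apply/negP => le; apply: H; exists n; split => //.
  by exists m; rewrite nm.
(* By minimality of [m], [G (u n) (u n) (u m)] exceeds [e] by at most the last step. *)
pose P m := (n <= m)%N && (e <= G (u n) (u n) (u m)).
case: (ex_minnP (ex_intro P m0 H0)) => m /andP[nm eD] mmin.
have {}nm : (n < m)%N.
  rewrite ltn_neqAle nm andbT; apply: contraTneq eD => <-.
  by rewrite Gxxx -ltNge.
case: m nm eD mmin => // k nk eD mmin.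
have Dk : G (u n) (u n) (u k) < e.
  rewrite ltNge; apply/negP => le; have := mmin k.
  by rewrite /P -ltnS nk le ltnn => /(_ isT).
have aN := HN _ nN; have kN : (N <= k)%N by apply: leq_trans nN _.
have ak := HN _ kN; have ak' := HN _ (leqW kN).
have [M1 M2 s1 s2] := contraction_max_near aN ak'.
have t := tri3 (u k) (u n) (u n) (u k.+1); have t' := dbl (u k.+1) (u k).
exists (u n), (u n), (u k.+1); split => //.
- exact/orbit_nondecreasing/ltnW.
- by rewrite ltr_distl; lra.
- by rewrite ltr_distl; lra.
Qed.

(** [T \o u] is the shifted orbit, so it converges both to [T x] and to [x]. *)
Lemma limit_fixed_continuous x : G_continuous G T -> G_cvg G u x -> T x = x.
Proof.
move=> Tc ux; apply: (G_cvg_unique G_metric) (Tc _ _ ux) _.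
exact: (G_cvgS G_metric) ux.
Qed.

(** Regularity makes [(u N, x, x)] a chain. In the maximum, [G x (T x) (T x)] appears as the step
    term of [x]; the average is at most about half of it and the rest is small. *)
Lemma limit_fixed_regular x : regular_nondecreasing G -> G_cvg G u x -> T x = x.
Proof.
move=> Hreg ux; have ule n := Hreg _ _ orbit_nondecreasing ux n.
apply/esym/(G_eq0 G_metric); apply: (T_gap (G0 _ _ _)) => r r0.
move: ux => /(G_cvgP G_metric) /(_ (r / 8)) [|N HN].
  by rewrite divr_gt0.
exists (u N), x, x; split => //.
- have h := HN _ _ (leqnSn N) (leqnSn N).
  have := tri1 x (u N.+1) (T x) (T x); have := tri1 (u N.+1) x (T x) (T x).
  have := dbl (u N.+1) x; rewrite -[T (u N)]/(u N.+1) ltr_distl; lra.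
- have h := HN _ _ (leqnn N) (leqnn N).
  have h1 := HN _ _ (leqnn N) (leqnSn N).
  have h2 := HN _ _ (leqnSn N) (leqnSn N).
  rewrite ltr_distl; apply/andP; split.
    apply: (@lt_le_trans _ _ (G x (T x) (T x))); first lra.
    by rewrite /contraction_max !le_max lexx !orbT.
  apply: (@le_lt_trans _ _ (G x (T x) (T x) + r / 2)); last lra.
  have p0 := G0 x (T x) (T x).
  have e1 : G (u N) (T (u N)) x < r / 8 by rewrite C13 C23.
  have e2 := dbl (u N) x; have e3 := tri1 x (u N) (T x) (T x).
  have e4 := dbl (u N.+1) x.
  rewrite /contraction_max !ge_max -[T (u N)]/(u N.+1) in e1 *.
  by repeat (apply/andP; split); lra.
Qed.

End FixedPoint.

(** * Existence and uniqueness of the fixed point *)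

Theorem theorem3p1 (R : realType) (d : Order.disp_t) (X : porderType d)
  (X_nonempty : [set: X] !=set0)
  (G : X -> X -> X -> R) (T : X -> X)
  (G_metric : is_Gmetric G)
  (X_complete : G_complete G)
  (T_cont_or_regular : G_continuous G T \/ regular_nondecreasing G)
  (T_nondecreasing : {homo T : x y / (x <= y)%O})
  (T_start : exists x0 : X, (x0 <= T x0)%O)
  (T_contraction : exists psi phi : R -> R,
    [/\ Psi psi, Phi phi &
      forall x y z : X, (x <= y)%O -> (y <= z)%O ->
        psi (G (T x) (T y) (T z)) <=
          psi (contraction_max G T x y z) - phi (contraction_max G T x y z)])
  (T_fixed_points : forall x y : X, fixed_points T x -> fixed_points T y ->
    exists z : X, [/\ (x <= z)%O, (y <= z)%O &
      exists l : X, G_cvg G (fun m => iter m T z) l]) :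
  exists! x : X, fixed_points T x.
Proof.
have [psi [phi [Hpsi Hphi contr]]] := T_contraction.
have gap (e : R) : 0 <= e -> (forall r : R, 0 < r -> exists x y z,
    [/\ (x <= y)%O, (y <= z)%O, `|G (T x) (T y) (T z) - e| < r &
     `|contraction_max G T x y z - e| < r]) -> e = 0.
  move=> e0 H; apply: (gap_eq0 Hpsi Hphi e0) => r /H [x [y [z [xy yz s t]]]].
  exists (G (T x) (T y) (T z)), (contraction_max G T x y z).
  by split => //; exact: contr.
have [x0 x0T] := T_start.
have [x ux] := X_complete _ (orbit_cauchy G_metric T_nondecreasing gap x0T).
have Tx : T x = x.
  case: T_cont_or_regular => H.
  - exact: (limit_fixed_continuous G_metric H ux).
  - exact: (limit_fixed_regular G_metric T_nondecreasing gap x0T H ux).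
exists x; split => // y Ty.
(* Both fixed points lie below [z], so each equals the limit [l] of its iterates. *)
have [z [xz yz [l zl]]] := T_fixed_points _ _ Tx Ty.
have lim := fixed_point_le_limit G_metric T_nondecreasing gap.
by rewrite (lim _ _ _ Tx xz zl) (lim _ _ _ Ty yz zl).
Qed.
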